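(* Let $d,D\ge1$ be integers and let $\mathcal X\subset\mathbb R^d$ be nonempty with base point $\mathrm e\in\mathcal X$. For each integer $L\ge2$ let $R_L$ be the extended representation cost of depth-$L$ ReLU networks with weight decay on $\mathrm{Lip}(\mathcal X;\mathbb R^D)$, $\mathcal F_L=\{f:R_L(f)<+\infty\}$, and $\|f\|_{\mathcal F_L}=\max\{R_L(f)^{L/2},\|f(\mathrm e)\|_2\}$. Then for every $L\ge2$ the inclusion map $\mathcal F_L\hookrightarrow\mathcal F_{L+1}$ is (well defined and) continuous with respect to the quasi-Banach topologies induced by the quasi-norms $\|\cdot\|_{\mathcal F_L}$ and $\|\cdot\|_{\mathcal F_{L+1}}$. In particular, there exists a constant $C_{L,D}<+\infty$ such that $$\|f\|_{\mathcal F_{L+1}}\le C_{L,D}\|f\|_{\mathcal F_L},\qquad f\in\mathcal F_L.$$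
   Context: **Lipschitz space and weak\* topology.** $\mathcal X\subset\mathbb R^d$ carries the Euclidean metric. $\mathrm{Lip}(\mathcal X;\mathbb R^D)$ is the space of Lipschitz maps $f:\mathcal X\to\mathbb R^D$, with norm $\max\{|f|_{\mathrm{Lip}},\|f(\mathrm e)\|_2\}$, $|f|_{\mathrm{Lip}}=\sup_{x\ne y}\|f(x)-f(y)\|_2/\|x-y\|_2$. The Arens–Eells space $\mathrm{AE}(\mathcal X)$ is the completion of the span of $\{\delta_x-\delta_y:x,y\in\mathcal X\}$ under $\|m\|=\inf\{\sum_i|a_i|\,\|x_i-y_i\|_2: m=\sum_i a_i(\delta_{x_i}-\delta_{y_i})\}$; it is the predual of the scalar Lipschitz functions vanishing at $\mathrm e$, via $\langle\sum_i a_i(\delta_{x_i}-\delta_{y_i}),g\rangle=\sum_i a_i(g(x_i)-g(y_i))$. $\mathrm{Lip}(\mathcal X;\mathbb R^D)$ is isometrically the dual of $(\mathrm{AE}(\mathcal X)\widehat\otimes_\pi\mathbb R^D)\oplus_1\mathbb R^D$, and $w^*$ is the corresponding weak\* topology: the coarsest topology making $f\mapsto\langle m,f_j-f_j(\mathrm e)\rangle$ and $f\mapsto f_j(\mathrm e)$ continuous for all components $j$ and all $m\in \mathrm{AE}(\mathcal X)$. **Lower semicontinuous regularization.** A function $K$ on a topological space with values in $[-\infty,+\infty]$ is l.s.c. if all sublevel sets $\{K\le\alpha\}$, $\alpha\in\mathbb R$, are closed. Its l.s.c. regularization is the largest l.s.c. function bounded above by $K$. **Deep ReLU networks.** $\Theta_L$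 is the set of tuples $\theta=((W_1,b_1),\dots,(W_L,b_L))$ with $W_\ell\in\mathbb R^{K_{\ell+1}\times K_\ell}$, $b_\ell\in\mathbb R^{K_{\ell+1}}$, $K_1=d$, $K_{L+1}=D$, and arbitrary finite hidden widths $K_2,\dots,K_L\in\mathbb N$. Set $f_\theta=a_L\circ\sigma\circ a_{L-1}\circ\cdots\circ\sigma\circ a_1$ restricted to $\mathcal X$, $a_\ell(z)=W_\ell z+b_\ell$, $\sigma=\max\{0,\cdot\}$ entrywise. The parameter cost is $C_L(\theta)=\frac1L\sum_{\ell=1}^L\|W_\ell\|_F^2$. Define $R_{\Theta_L}(f)=\inf\{C_L(\theta):\theta\in\Theta_L,\ f_\theta=f\}$ for $f\in\mathrm{Lip}(\mathcal X;\mathbb R^D)$ ($\inf\varnothing=+\infty$). $R_L$ is the $w^*$-l.s.c. regularization of $R_{\Theta_L}$ on $\mathrm{Lip}(\mathcal X;\mathbb R^D)$. The function $\|\cdot\|_{\mathcal F_L}$ is a quasi-norm making $\mathcal F_L$ a quasi-Banach space; its topology is the vector topology with the balls $\{\|f\|_{\mathcal F_L}<r\}$, $r>0$, as a base of neighborhoods of $0$ (up to equivalence). *)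

(* Defs.v *)
From HB Require Import structures.
From mathcomp Require Import all_boot all_order all_algebra.
From mathcomp Require Import all_classical all_reals all_analysis.
From mathcomp Require Import ring.

Set Implicit Arguments.
Unset Strict Implicit.
Unset Printing Implicit Defensive.

Import Order.TTheory GRing.Theory Num.Theory.
Import numFieldNormedType.Exports.

Local Open Scope classical_set_scope.
Local Open Scope ring_scope.

Section euclidean_norm.
Context {R : realType}.

(* The library norm on matrices is the sup norm; [enorm] is the Frobenius norm,
   that is, the Euclidean norm on column vectors. *)
Definition enorm m n (A : 'M[R]_(m, n)) : R :=
  Num.sqrt (\sum_i \sum_j A i j ^+ 2).

Lemma enorm_ge0 m n (A : 'M[R]_(m, n)) : 0 <= enorm A.
Proof. exact: sqrtr_ge0. Qed.

Lemma enorm_sqr m n (A : 'M[R]_(m, n)) :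
  enorm A ^+ 2 = \sum_i \sum_j A i j ^+ 2.
Proof.
by rewrite sqr_sqrtr//; apply: sumr_ge0 => i _; apply: sumr_ge0 => j _;
  exact: sqr_ge0.
Qed.

Lemma enorm0 m n : enorm (0 : 'M[R]_(m, n)) = 0.
Proof.
rewrite /enorm big1 ?sqrtr0// => i _.
by rewrite big1// => j _; rewrite mxE expr0n.
Qed.

Lemma enormZ m n a (A : 'M[R]_(m, n)) : enorm (a *: A) = `|a| * enorm A.
Proof.
rewrite /enorm -sqrtr_sqr -sqrtrM ?sqr_ge0//; congr Num.sqrt.
rewrite mulr_sumr; apply: eq_bigr => i _; rewrite mulr_sumr.
by apply: eq_bigr => j _; rewrite mxE exprMn.
Qed.

Lemma enorm_eq0 m n (A : 'M[R]_(m, n)) : enorm A = 0 -> A = 0.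
Proof.
move=> A0; apply/matrixP => i j; rewrite mxE.
have /eqP : \sum_i \sum_j A i j ^+ 2 = 0 by rewrite -enorm_sqr A0 expr0n.
rewrite psumr_eq0; last by move=> k _; apply: sumr_ge0 => l _; exact: sqr_ge0.
move/allP => /(_ i (mem_index_enum _))/=.
rewrite psumr_eq0; last by move=> l _; exact: sqr_ge0.
move/allP => /(_ j (mem_index_enum _))/=.
by rewrite sqrf_eq0 => /eqP.
Qed.

Lemma enormD m n (A B : 'M[R]_(m, n)) : enorm (A + B) <= enorm A + enorm B.
Proof.
have [/enorm_eq0 ->|A0] := eqVneq (enorm A) 0; first by rewrite enorm0 !add0r.
have [/enorm_eq0 ->|B0] := eqVneq (enorm B) 0; first by rewrite enorm0 !addr0.
set dot := \sum_i \sum_j A i j * B i j.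
have sqrD (s t : R) : enorm (s *: A + t *: B) ^+ 2 =
    s ^+ 2 * enorm A ^+ 2 + (s * t) *+ 2 * dot + t ^+ 2 * enorm B ^+ 2.
  rewrite !enorm_sqr /dot !mulr_sumr -!big_split/=; apply: eq_bigr => i _.
  rewrite !mulr_sumr -!big_split/=; apply: eq_bigr => j _.
  rewrite !mxE sqrrD !exprMn; congr (_ + _ + _).
  by rewrite mulrACA mulrnAl.
have dot_le : dot <= enorm A * enorm B.
  have AB_gt0 : 0 < enorm A * enorm B.
    by rewrite mulr_gt0// lt_neqAle eq_sym ?A0 ?B0 enorm_ge0.
  have := sqr_ge0 (enorm (enorm B *: A + (- enorm A) *: B)).
  have -> : enorm (enorm B *: A + - enorm A *: B) ^+ 2 =
      (enorm A * enorm B * (enorm A * enorm B - dot)) *+ 2 by rewrite sqrD; ring.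
  by rewrite pmulrn_lge0// pmulr_rge0// subr_ge0.
rewrite -(@ler_pXn2r _ 2) ?nnegrE ?addr_ge0 ?enorm_ge0//.
have := sqrD 1 1; rewrite !scale1r expr1n !mul1r => ->.
by rewrite sqrrD lerD2r lerD2l mulr_natl lerMn2r dot_le orbT.
Qed.

End euclidean_norm.

Section lipschitz_space.
Context {R : realType} (d D : nat) (X : set 'cV[R]_d).

Definition is_lip : {pred (X -> 'cV[R]_D)} := fun f =>
  `[< exists k : R,
      forall x y : X, enorm (f x - f y) <= k * enorm (val x - val y) >].

Lemma is_lip_submod_closed : submod_closed is_lip.
Proof.
split.
  apply/asboolP; exists 0 => x y.
  by rewrite mul0r subrr enorm0.
move=> a f g /asboolP[k fk] /asboolP[l gl]; apply/asboolP.
exists (`|a| * k + l) => x y.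
have -> : (a *: f + g) x - (a *: f + g) y = a *: (f x - f y) + (g x - g y).
  by rewrite scalerBr addrACA -opprD.
rewrite (le_trans (enormD _ _))// enormZ mulrDl lerD// -mulrA.
by rewrite ler_wpM2l.
Qed.

HB.instance Definition _ :=
  GRing.isSubmodClosed.Build R (X -> 'cV[R]_D) is_lip is_lip_submod_closed.

Record Lip := MkLip { lip_fun :> X -> 'cV[R]_D ; _ : lip_fun \in is_lip }.

HB.instance Definition _ := [isSub for lip_fun].
HB.instance Definition _ := [Choice of Lip by <:].
HB.instance Definition _ := [SubChoice_isSubZmodule of Lip by <:].
HB.instance Definition _ := [SubZmodule_isSubLmodule of Lip by <:].

End lipschitz_space.

Section arens_eells.
Context {R : realType} (d : nat) (X : set 'cV[R]_d).

(* The list of triples (a_i, (x_i, y_i)) stands for the formal combination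
   \sum_i a_i (delta_{x_i} - delta_{y_i}); [molecule] is that combination as a
   finitely supported function. *)
Definition combination := seq (R * (X * X)).

Definition molecule (s : combination) : X -> R := fun z =>
  \sum_(p <- s) p.1 * ((p.2.1 == z)%:R - (p.2.2 == z)%:R).

Definition transport_cost (s : combination) : R :=
  \sum_(p <- s) `|p.1| * enorm (val p.2.1 - val p.2.2).

Definition ae_norm (m : X -> R) : R :=
  inf [set transport_cost s | s in [set s | molecule s = m]].

Definition comb_pairing (s : combination) (g : X -> R) : R :=
  \sum_(p <- s) p.1 * (g p.2.1 - g p.2.2).

(* Points of the completion are represented by Cauchy sequences. Sequences
   whose difference tends to 0 represent the same point; they have the same
   pairing with Lipschitz functions, so the quotient is not formed. *)
Record AE := MkAE {
  ae_seq :> nat -> combination ;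
  ae_cauchy : forall eps : R, 0 < eps -> exists N, forall n m : nat,
    (N <= n)%N -> (N <= m)%N ->
    ae_norm (molecule (ae_seq n) - molecule (ae_seq m)) < eps }.

Definition ae_pairing (m : AE) (g : X -> R) : R :=
  limn (fun n => comb_pairing (m n) g).

End arens_eells.

Section weak_star.
Context {R : realType} (d D : nat) (X : set 'cV[R]_d) (e : X).

Definition wstar_eval (i : (AE X * 'I_D) + 'I_D) (f : Lip D X) : R :=
  match i with
  | inl (m, j) => ae_pairing m (fun x => f x j 0 - f e j 0)
  | inr j => f e j 0
  end.

Definition wstar : topologicalType :=
  sup_topology (fun i => Topological.on (initial_topology (wstar_eval i))).

End weak_star.

Section lsc_regularization.
Context {R : realType} {T : topologicalType}.
Local Open Scope ereal_scope.

Lemma lower_semicontinuous_closed (K : T -> \bar R) :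
  lower_semicontinuous K <-> forall a : R, closed [set x | K x <= a%:E].
Proof.
have E a : [set x | K x <= a%:E] = ~` [set x | a%:E < K x].
  by apply/seteqP; split => x /=; [rewrite leNgt => /negP|move/negP; rewrite -leNgt].
rewrite lower_semicontinuousP; split=> KP a.
  by rewrite E; exact: open_closedC.
by rewrite -[X in open X]setCK -E; exact: closed_openC.
Qed.

Definition lsc_reg (K : T -> \bar R) (x : T) : \bar R :=
  ereal_sup [set G x | G in
    [set G : T -> \bar R | lower_semicontinuous G /\ forall y, G y <= K y]].

Lemma lsc_reg_le (K : T -> \bar R) x : lsc_reg K x <= K x.
Proof. by apply: ge_ereal_sup => _ [G [_ GK] <-]. Qed.

Lemma lsc_reg_max (K G : T -> \bar R) : lower_semicontinuous G ->
  (forall y, G y <= K y) -> forall x, G x <= lsc_reg K x.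
Proof. by move=> Glsc GK x; apply: ereal_sup_ubound; exists G. Qed.

Lemma lsc_reg_lsc (K : T -> \bar R) : lower_semicontinuous (lsc_reg K).
Proof.
move=> x a /ereal_sup_gt[_ [G [Glsc GK] <-] aG].
have [V Vx VG] := Glsc x a aG; exists V => // y /VG /lt_le_trans; apply.
exact: lsc_reg_max.
Qed.

End lsc_regularization.

Section relu_networks.
Context {R : realType} (D : nat).

(* [network L k]: parameters ((W_1, b_1), ..., (W_L, b_L)) of the networks with
   L affine layers from R^k to R^D, the hidden widths being arbitrary. *)
Inductive network : nat -> nat -> Type :=
| Output k (W : 'M[R]_(D, k)) (b : 'cV[R]_D) : network 1 k
| Hidden L k k' (W : 'M[R]_(k', k)) (b : 'cV[R]_k') (theta : network L k') :
    network L.+1 k.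

Definition relu k (z : 'cV[R]_k) : 'cV[R]_k := map_mx (Num.max 0) z.

Fixpoint realization L k (theta : network L k) : 'cV[R]_k -> 'cV[R]_D :=
  match theta with
  | Output _ W b => fun z => W *m z + b
  | Hidden _ _ _ W b theta' => fun z => realization theta' (relu (W *m z + b))
  end.

Fixpoint weight_sqnorm L k (theta : network L k) : R :=
  match theta with
  | Output _ W _ => enorm W ^+ 2
  | Hidden _ _ _ W _ theta' => enorm W ^+ 2 + weight_sqnorm theta'
  end.

Definition param_cost L k (theta : network L k) : R :=
  L%:R^-1 * weight_sqnorm theta.

End relu_networks.

Section representation_cost.
Context {R : realType} (d D : nat) (X : set 'cV[R]_d) (e : X) (L : nat).
Local Open Scope ereal_scope.

Definition repcost_param (f : Lip D X) : \bar R :=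
  ereal_inf [set (param_cost theta)%:E | theta in
    [set theta : network D L d |
      forall x : X, realization theta (val x) = f x]].

Definition repcost : Lip D X -> \bar R :=
  @lsc_reg R (wstar D e) repcost_param.

Definition Fnorm (f : Lip D X) : \bar R :=
  maxe (repcost f `^ (L%:R / 2)) (enorm (f e))%:E.

Record Fspace := MkF { F_lip :> Lip D X ; _ : repcost F_lip < +oo }.

HB.instance Definition _ := [isSub for F_lip].
HB.instance Definition _ := [Choice of Fspace by <:].

(* U is open when it contains, around each of its points f, a translated ball
   f + {h | Fnorm h < r}: the translation-invariant topology for which the balls
   of the quasi-norm are a base of neighbourhoods of 0. *)
Definition Fopen : set_system Fspace := [set U | forall f, U f ->
  exists2 r : R, (0 < r)%R &
    forall g : Fspace, Fnorm (F_lip g - F_lip f)%R < r%:E -> U g].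

Let FopenT : Fopen setT.
Proof. by move=> f _; exists 1%R. Qed.

Let FopenI : setI_closed Fopen.
Proof.
move=> U V Uop Vop f [/Uop[r r0 rU] /Vop[s s0 sV]].
exists (Num.min r s); first by rewrite lt_min r0.
by move=> g; rewrite EFin_min lt_min => /andP[/rU Ug /sV Vg].
Qed.

Let Fopen_bigU (I : Type) (U : I -> set Fspace) :
  (forall i, Fopen (U i)) -> Fopen (\bigcup_i U i).
Proof.
move=> Uop f [i _ /(Uop i)[r r0 rU]].
by exists r => // g /rU Ug; exists i.
Qed.

HB.instance Definition _ :=
  isOpenTopological.Build Fspace FopenT FopenI Fopen_bigU.

Lemma open_FspaceE : @open Fspace = Fopen.
Proof. by []. Qed.

End representation_cost.

(* Main.v *)
Require Import Defs.
From mathcomp Require Import all_boot all_order all_algebra.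
From mathcomp Require Import all_classical all_reals all_analysis.
From mathcomp Require Import lra.

(** Since z = relu z - relu (- z), a depth-L network becomes a network of depth
    L + 1 by doubling its output layer and appending the layer (I, -I).
    Multiplying the first L weight matrices by c and the appended one by c^-L
    does not change the realization, and optimizing over c bounds the cost at
    depth L + 1 by a constant times the power L / (L + 1) of the cost at depth
    L. This increasing power can be moved to the other side of the inequality,
    where it preserves lower semicontinuity, so the bound passes to the
    regularizations. *)

Set Implicit Arguments.
Unset Strict Implicit.
Unset Printing Implicit Defensive.

Import Order.TTheory GRing.Theory Num.Theory.
Import numFieldNormedType.Exports.

Local Open Scope classical_set_scope.
Local Open Scope ring_scope.

(** * Frobenius norms of scaled, block and scalar matrices *)

Section frobenius_norm.
Context {R : realType}.

Lemma enorm_sqrZ m n a (A : 'M[R]_(m, n)) :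
  enorm (a *: A) ^+ 2 = a ^+ 2 * enorm A ^+ 2.
Proof. by rewrite enormZ exprMn real_normK ?num_real. Qed.

Lemma enormN m n (A : 'M[R]_(m, n)) : enorm (- A) = enorm A.
Proof. by rewrite -scaleN1r enormZ normrN1 mul1r. Qed.

Lemma enorm_sqr_col_mx m1 m2 n (A : 'M[R]_(m1, n)) (B : 'M[R]_(m2, n)) :
  enorm (col_mx A B) ^+ 2 = enorm A ^+ 2 + enorm B ^+ 2.
Proof.
rewrite !enorm_sqr big_split_ord/=; congr (_ + _); apply: eq_bigr => i _.
  by apply: eq_bigr => j _; rewrite col_mxEu.
by apply: eq_bigr => j _; rewrite col_mxEd.
Qed.

Lemma enorm_sqr_row_mx m n1 n2 (A : 'M[R]_(m, n1)) (B : 'M[R]_(m, n2)) :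
  enorm (row_mx A B) ^+ 2 = enorm A ^+ 2 + enorm B ^+ 2.
Proof.
rewrite !enorm_sqr -big_split/=; apply: eq_bigr => i _.
rewrite big_split_ord/=; congr (_ + _); apply: eq_bigr => j _.
  by rewrite row_mxEl.
by rewrite row_mxEr.
Qed.

Lemma enorm_sqr_scalar_mx n (a : R) : enorm (a%:M : 'M[R]_n) ^+ 2 = a ^+ 2 *+ n.
Proof.
rewrite enorm_sqr (eq_bigr (fun=> a ^+ 2)) ?sumr_const ?card_ord// => i _.
rewrite (bigD1 i)//= !mxE eqxx mulr1n big1 ?addr0// => j ji.
by rewrite mxE eq_sym (negbTE ji) mulr0n expr0n.
Qed.

End frobenius_norm.

(** * Trading scale for one more layer *)

Section deepening.
Context {R : realType} (D : nat).

Lemma reluZ k (c : R) (z : 'cV[R]_k) : 0 <= c -> relu (c *: z) = c *: relu z.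
Proof.
by move=> c0; apply/matrixP => i j; rewrite !mxE maxr_pMr// mulr0.
Qed.

Lemma relu_col_mx k1 k2 (z1 : 'cV[R]_k1) (z2 : 'cV[R]_k2) :
  relu (col_mx z1 z2) = col_mx (relu z1) (relu z2).
Proof. exact: map_col_mx. Qed.

Lemma reluBN k (z : 'cV[R]_k) : relu z - relu (- z) = z.
Proof.
apply/matrixP => i j; rewrite !mxE.
by case: (lerP 0 (z i j)) => z0; case: (lerP 0 (- z i j)) => z1; lra.
Qed.

Lemma weight_sqnorm_ge0 L k (theta : network D L k) :
  0 <= weight_sqnorm (R := R) theta.
Proof.
elim: theta => /= [*|*]; first exact: sqr_ge0.
by rewrite addr_ge0// sqr_ge0.
Qed.

(* The biases of the successive layers have to be scaled by increasing powers
   of [c]; the factor [a] accumulates these powers along the induction. *)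
Lemma network_deepen L k (theta : network D L k) (a c v : R) :
  0 <= a -> 0 <= c ->
  exists theta' : network D L.+1 k,
    (forall z, realization theta' (a *: z) =
               (a * c ^+ L * v) *: realization theta z) /\
    weight_sqnorm theta' <=
      2 * c ^+ 2 * weight_sqnorm theta + 2 * D%:R * v ^+ 2.
Proof.
elim: theta a => [{}k W b|{}L {}k k' W b theta IH] a a0 c0.
  exists (Hidden (col_mx (c *: W) (- (c *: W)))
      (col_mx ((a * c) *: b) (- ((a * c) *: b)))
      (Output (row_mx v%:M (- v%:M)) 0)); split => [z|] /=.
    rewrite mul_col_mx add_col_mx relu_col_mx mul_row_col addr0.
    rewrite !mulNmx -opprD -mulmxBr reluBN mul_scalar_mx expr1.
    by rewrite -scalemxAl -scalemxAr scalerA (mulrC c a) -scalerDr scalerA (mulrC v).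
  rewrite enorm_sqr_col_mx enorm_sqr_row_mx !enormN enorm_sqrZ.
  by rewrite enorm_sqr_scalar_mx -mulr_natl; lra.
have [theta' [theta'E theta'_le]] := IH (a * c) (mulr_ge0 a0 c0) c0.
exists (Hidden (c *: W) ((a * c) *: b) theta'); split => [z|] /=.
  have -> : (c *: W) *m (a *: z) + (a * c) *: b = (a * c) *: (W *m z + b).
    by rewrite -scalemxAl -scalemxAr scalerA (mulrC c a) scalerDr.
  by rewrite reluZ ?mulr_ge0// theta'E exprS !mulrA.
(* A hidden layer is not doubled: it uses half of what the bound allows. *)
rewrite enorm_sqrZ; have := mulr_ge0 (sqr_ge0 c) (sqr_ge0 (enorm W)); lra.
Qed.

(* The rescaling factor of [network_deepen] is [u^-1]. *)
Lemma network_deepen_le L k (theta : network D L k) (u : R) : 0 < u ->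
  weight_sqnorm theta <= u ^+ (2 * L.+1) ->
  exists theta' : network D L.+1 k,
    realization theta' =1 realization theta /\
    weight_sqnorm theta' <= (2 + 2 * D%:R) * u ^+ (2 * L).
Proof.
move=> u0 thetau.
(* With [v = u ^+ L] the realization is multiplied by 1, and each term of the bound is at most a
   multiple of [u ^+ (2 * L)]. *)
have [||theta' [theta'E theta'_le]] :=
  @network_deepen L k theta 1 u^-1 (u ^+ L); rewrite ?invr_ge0 ?(ltW u0)//.
exists theta'; split => [z|].
  rewrite -[z in LHS]scale1r theta'E mul1r -exprMn mulVf ?gt_eqF//.
  by rewrite expr1n scale1r.
apply: (le_trans theta'_le); rewrite -exprM (mulnC L) [leRHS]mulrDl lerD2r -mulrA.
rewrite ler_pM2l// exprVn ler_pdivrMl ?exprn_gt0//.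
by rewrite -exprD -mulnS.
Qed.

End deepening.

(** * Powers of lower semicontinuous functions *)

Section poweR_lower_semicontinuous.
Context {R : realType}.
Local Open Scope ereal_scope.

Lemma le_poweR2r (x y : \bar R) (q : R) : 0 <= x -> (0 <= q)%R -> x <= y ->
  x `^ q <= y `^ q.
Proof.
move=> x0 q0 xy; apply: gt0_ler_poweR => //; rewrite in_itv/= leey andbT//.
exact: le_trans xy.
Qed.

(** The powers [q] and [q^-1] are inverse increasing maps of [[0, +oo]]. *)
Lemma poweR_leEr (x : \bar R) (a q : R) : 0 <= x -> (0 <= a)%R -> (0 < q)%R ->
  (x `^ q <= a%:E) = (x <= (a `^ q^-1)%:E).
Proof.
move=> x0 a0 q0; apply/idP/idP => h.
  rewrite -[x]poweRe1// -(@mulfV _ q) ?gt_eqF// poweRrM -poweR_EFin.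
  by rewrite le_poweR2r ?poweR_ge0 ?invr_ge0// ltW.
rewrite -[a]powRr1// -(@mulVf _ q) ?gt_eqF// powRrM -poweR_EFin.
by rewrite le_poweR2r// ltW.
Qed.

Lemma lower_semicontinuous_poweR (T : topologicalType) (F : T -> \bar R)
    (k q : R) : (0 < k)%R -> (0 < q)%R -> (forall y, 0 <= F y) ->
  lower_semicontinuous F -> lower_semicontinuous (fun y => (k%:E * F y) `^ q).
Proof.
move=> k0 q0 F0 Flsc x a; have [a0|a0] := leP 0%R a; last first.
  (* For negative [a] the whole space works, powers being nonnegative. *)
  by exists setT => [|y _]; [exact: filterT|exact/(lt_le_trans _ (poweR_ge0 _ _))].
have kF0 y : 0 <= k%:E * F y by rewrite mule_ge0// lee_fin ltW.
have E y : (a%:E < (k%:E * F y) `^ q) = ((k^-1 * a `^ q^-1)%:E < F y).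
  by rewrite !ltNge poweR_leEr// EFinM lee_pdivlMl.
rewrite E => /Flsc[V Vx VF]; exists V => // y /VF.
by rewrite E.
Qed.

End poweR_lower_semicontinuous.

(** * Comparison of depths [L] and [L.+1] *)

Section inclusion.
Context {R : realType} (d D : nat) (X : set 'cV[R]_d) (e : X).
Local Open Scope ereal_scope.

Lemma repcost_param_ge0 L (f : Lip D X) : 0 <= repcost_param L f.
Proof.
apply: le_ereal_inf_tmp => _ [theta _ <-].
by rewrite lee_fin mulr_ge0 ?invr_ge0 ?weight_sqnorm_ge0.
Qed.

(** The constant 0 is a lower semicontinuous minorant of [repcost_param]. *)
Lemma repcost_ge0 L (f : Lip D X) : 0 <= repcost e L f.
Proof.
apply: (@lsc_reg_max _ (wstar D e) _ (cst 0)); last exact: repcost_param_ge0.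
by move=> x a a0; exists setT => [|y _//]; exact: filterT.
Qed.

Lemma repcostS_le_param L (f : Lip D X) : (0 < L)%N ->
  ((2 + 2 * D%:R)^-1%:E * repcost e L.+1 f) `^ (L.+1%:R / L%:R)
    <= repcost_param L f.
Proof.
move=> L0; apply: le_ereal_inf_tmp => _ [theta thetaf <-].
have K0 : (0 < 2 + 2 * D%:R :> R)%R by rewrite ltr_pwDl// mulr_ge0.
have Lr0 : (0 < L%:R :> R)%R by rewrite ltr0n.
have L1r0 : (0 < L.+1%:R :> R)%R by rewrite ltr0n.
(* The margin [eps] keeps [t], hence [u], positive even if all weights vanish; the factor [L%:R] in
   [t] makes [t / L] the cost plus [eps]. *)
apply/lee_addgt0Pr => eps eps0.
set t := (weight_sqnorm theta + L%:R * eps)%R.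
have t0 : (0 < t)%R by rewrite ltr_wpDl ?weight_sqnorm_ge0 ?mulr_gt0.
pose u := (t `^ (2 * L.+1)%:R^-1)%R.
have u0 : (0 < u)%R by rewrite powR_gt0.
have uE : (u ^+ (2 * L.+1) = t)%R.
  rewrite -powR_mulrn ?ltW// -powRrM mulVf ?pnatr_eq0//.
  by rewrite powRr1 ?ltW.
have [|theta' [theta'E theta'_le]] := network_deepen_le u0 (theta := theta).
  by rewrite uE lerDl mulr_ge0// ltW.
have Rle : (2 + 2 * D%:R)^-1%:E * repcost e L.+1 f <=
    (L.+1%:R^-1 * u ^+ (2 * L))%:E.
  rewrite lee_pdivrMl// -EFinM.
  apply: (le_trans (lsc_reg_le (T := wstar D e) _ _)).
  apply: (@le_trans _ _ (param_cost theta')%:E).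
    by apply: ereal_inf_lbound; exists theta' => // x; rewrite theta'E.
  by rewrite lee_fin /param_cost mulrCA ler_pM2l ?invr_gt0.
apply: (le_trans (le_poweR2r _ _ Rle)).
- by rewrite mule_ge0 ?repcost_ge0// lee_fin invr_ge0 ltW.
- by rewrite divr_ge0.
rewrite poweR_EFin -EFinD lee_fin powRM ?invr_ge0 ?exprn_ge0 ?(ltW u0)//.
have -> : ((u ^+ (2 * L)) `^ (L.+1%:R / L%:R) = t)%R.
  rewrite -powR_mulrn ?ltW// -powRrM natrM mulrACA mulfV ?gt_eqF// mulr1.
  by rewrite -natrM powR_mulrn ?ltW.
have -> : (param_cost theta + eps = L%:R^-1 * t)%R.
  by rewrite mulrDr mulKf ?gt_eqF.
(* The base [L.+1%:R^-1] is at most 1 and the exponent at least 1, so the power is at most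
   [L.+1%:R^-1], hence at most [L%:R^-1]. *)
rewrite ler_wpM2r ?(ltW t0)// (@le_trans _ _ L.+1%:R^-1%R)//.
  apply: ge1r_powR; first by rewrite invr_gt0 L1r0 invf_le1// ler1n.
  by rewrite ler_pdivlMr// mul1r ler_nat.
by rewrite lef_pV2 ?posrE// ler_nat.
Qed.

Lemma repcostS_le L (f : Lip D X) : (0 < L)%N ->
  ((2 + 2 * D%:R)^-1%:E * repcost e L.+1 f) `^ (L.+1%:R / L%:R)
    <= repcost e L f.
Proof.
move=> L0.
apply: (@lsc_reg_max _ (wstar D e) _ (fun g => _)) => [|g]; last first.
  exact: repcostS_le_param.
apply: lower_semicontinuous_poweR; last exact: lsc_reg_lsc.
- by rewrite invr_gt0 ltr_pwDl// mulr_ge0.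
- by rewrite divr_gt0 ?ltr0n.
- by move=> g; exact: repcost_ge0.
Qed.

(** A power with positive exponent is finite only if its base is, so [repcostS_le] transfers
    finiteness. *)
Lemma repcostS_lty L (f : Lip D X) : (0 < L)%N ->
  repcost e L f < +oo -> repcost e L.+1 f < +oo.
Proof.
move=> L0 /(le_lt_trans (repcostS_le f L0)) /lty_poweRy.
rewrite mulf_neq0 ?invr_neq0 ?pnatr_eq0 -?lt0n// => /(_ isT).
have := repcost_ge0 L.+1 f; case: (repcost e L.+1 f) => //= [r _ _|_].
  exact: ltry.
by rewrite gt0_muley// lte_fin invr_gt0 ltr_pwDl// mulr_ge0.
Qed.

(** Raising [repcostS_le] to the power [L / 2] produces the exponent [L.+1 / 2] of the quasi-norm at
    depth [L.+1]. *)
Lemma FnormS_le L (f : Lip D X) : (0 < L)%N ->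
  Fnorm e L.+1 f <= ((2 + 2 * D%:R) `^ (L.+1%:R / 2))%:E * Fnorm e L f.
Proof.
move=> L0; set K : R := (2 + 2 * D%:R)%R.
have K1 : (1 <= K)%R by rewrite /K; have : (0 <= D%:R :> R)%R by []; lra.
have K0 : (0 < K)%R by exact: lt_le_trans K1.
have KR0 : 0 <= K^-1%:E * repcost e L.+1 f.
  by rewrite mule_ge0 ?repcost_ge0// lee_fin invr_ge0 ltW.
have C0 : 0 <= (K `^ (L.+1%:R / 2))%:E by rewrite lee_fin powR_ge0.
rewrite {1}/Fnorm ge_max; apply/andP; split; last first.
  (* The value at [e] is the same at both depths, and the constant is at least 1 because [K] is. *)
  rewrite (@le_trans _ _ (Fnorm e L f))//; first by rewrite le_max lexx orbT.
  rewrite lee_pemull//; first by rewrite le_max poweR_ge0.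
  by rewrite lee_fin -[leLHS](powRr0 K) ler_powR// divr_ge0.
apply: (@le_trans _ _ ((K `^ (L.+1%:R / 2))%:E * repcost e L f `^ (L%:R / 2))).
  have -> : repcost e L.+1 f = K%:E * (K^-1%:E * repcost e L.+1 f).
    by rewrite muleA -EFinM mulfV ?gt_eqF// mul1e.
  rewrite poweRM ?lee_fin ?(ltW K0)// poweR_EFin lee_wpmul2l//.
  have -> : (L.+1%:R / 2 = L.+1%:R / L%:R * (L%:R / 2) :> R)%R.
    by rewrite mulrA divfK// pnatr_eq0 -lt0n.
  by rewrite poweRrM le_poweR2r ?poweR_ge0 ?divr_ge0 ?repcostS_le.
by rewrite lee_wpmul2l// le_max lexx.
Qed.

End inclusion.

Theorem corollary9p9 (R : realType) (L D : nat) (hL : (2 <= L)%N)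
    (hD : (1 <= D)%N) :
  (forall (d : nat) (hd : (1 <= d)%N) (X : set 'cV[R]_d) (e : X),
    exists incl : Fspace D e L -> Fspace D e L.+1,
      (forall f, F_lip (incl f) = F_lip f) /\ continuous incl) /\
  (exists C : R,
    forall (d : nat) (hd : (1 <= d)%N) (X : set 'cV[R]_d) (e : X)
      (f : Fspace D e L),
      (Fnorm e L.+1 f <= C%:E * Fnorm e L f)%E).
Proof.
have L0 : (0 < L)%N by exact: ltnW.
split; last first.
  by exists ((2 + 2 * D%:R) `^ (L.+1%:R / 2)) => d _ X e f; exact: FnormS_le.
move=> d _ X e.
exists (fun f => MkF (repcostS_lty L0 (valP f))); split => //.
apply/continuousP => U; rewrite !open_FspaceE => Uop f /Uop[r r0 rU].
have C0 : 0 < (2 + 2 * D%:R) `^ (L.+1%:R / 2) :> R.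
  by rewrite powR_gt0// ltr_pwDl// mulr_ge0.
(* [FnormS_le], applied to the Lipschitz map [g - f], sends the ball of radius [r] over the constant
   into that of radius [r]. *)
exists (((2 + 2 * D%:R) `^ (L.+1%:R / 2))^-1 * r).
  by rewrite mulr_gt0// invr_gt0.
move=> g; rewrite EFinM lte_pdivlMl// => gfr; apply: rU => /=.
exact: le_lt_trans (FnormS_le _ _ L0) gfr.
Qed.
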